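(* Let $I$ be an ideal of a numerical semigroup $S$, and let $n\geq 0$ and $d\geq 0$ be integers. Then $\mathcal{P}_n^d(I)$ is, under addition of polynomials, a semigroup with zero, i.e. a monoid.
   Context: $\mathbb{Z}_+$ denotes the set of non-negative integers. A numerical semigroup is a subset of $\mathbb{Z}_+$ that contains $0$, is closed under addition and has finite complement in $\mathbb{Z}_+$. An ideal of a numerical semigroup $S$ is a nonempty subset $I\subseteq S$ with $I+S\subseteq I$. A pattern admitted by the ideal $I$ of $S$ is a polynomial $p(X_1,\dots,X_n)$ with integer coefficients such that $p(s_1,\dots,s_n)\in S$ for every non-increasing sequence $s_1\ge\cdots\ge s_n$ of elements of $I$; its length is the number of indeterminates and its degree is the degree of the polynomial. $\mathcal{P}_n^d(I)$ denotes the set of patterns of length at most $n$ and degree at most $d$ admitted by $I$ (regarded as polynomials in $\mathbb{Z}[X_1,\dots,X_n]$); the zero polynomial counts as having length at most $n$ and degree at most $d$ for all $n,d\ge 0$. *)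

(* Defs.v *)
From HB Require Import structures.
From mathcomp Require Import all_boot all_order all_algebra.
From mathcomp Require Import boolp classical_sets functions cardinality.
From mathcomp Require Import mpoly.

Set Implicit Arguments.
Unset Strict Implicit.
Unset Printing Implicit Defensive.

Import Order.TTheory GRing.Theory Num.Theory.

Local Open Scope classical_set_scope.
Local Open Scope ring_scope.

Definition numerical_semigroup (S : set nat) : Prop :=
  [/\ S 0%N,
      forall a b : nat, S a -> S b -> S (a + b)%N
    & finite_set (~` S)].

Definition semigroup_ideal (S I : set nat) : Prop :=
  [/\ I !=set0,
      I `<=` S
    & forall a b : nat, I a -> S b -> I (a + b)%N].

(* The value of p is an integer, possibly negative: admission requires it to be
   the image of an element of S under the embedding of nat into int. *)
Definition admits_pattern (S I : set nat) (n : nat) (p : {mpoly int[n]}) : Prop :=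
  forall s : 'I_n -> nat,
    (forall i, I (s i)) ->
    (forall i j : 'I_n, (i <= j)%N -> (s j <= s i)%N) ->
    exists2 a : nat, S a & p.@[fun i => (s i)%:Z] = a%:Z.

(* Z[X_1, ..., X_m] regarded inside Z[X_1, ..., X_n] for m <= n, each
   indeterminate being sent to the one with the same index. *)
Definition mpoly_incl (m n : nat) (le_mn : (m <= n)%N) (p : {mpoly int[m]}) :
    {mpoly int[n]} :=
  p \mPo [tuple 'X_(widen_ord le_mn i) | i < m].

(* msize is the total degree plus one, and 0 on the zero polynomial, which thus
   has degree at most d for every d. *)
Definition patterns (S I : set nat) (n d : nat) : set {mpoly int[n]} :=
  fun q => exists (m : nat) (le_mn : (m <= n)%N) (p : {mpoly int[m]}),
    [/\ admits_pattern S I p, (msize p <= d.+1)%N & q = mpoly_incl le_mn p].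

Arguments patterns S I n d : clear implicits.

Definition semigroup_under (T : Type) (A : set T) (op : T -> T -> T) : Prop :=
  (forall x y, A x -> A y -> A (op x y)) /\
  (forall x y z, A x -> A y -> A z -> op x (op y z) = op (op x y) z).

Definition monoid_under (T : Type) (A : set T) (op : T -> T -> T) (e : T) : Prop :=
  [/\ semigroup_under A op, A e & forall x, A x -> op e x = x /\ op x e = x].

(* Main.v *)
Require Import Defs.
From HB Require Import structures.
From mathcomp Require Import all_boot all_order all_algebra.
From mathcomp Require Import boolp classical_sets functions cardinality.
From mathcomp Require Import mpoly.

(** Patterns are closed under addition because, at a given non-increasing
sequence of elements of [I], the value of a sum is the sum of the values, and
[S] is closed under addition; the zero polynomial takes only the value 0, which
lies in [S].  The degree bound passes to sums as usual.

What this argument leaves open is that two patterns of different lengths have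
to be compared: membership in [patterns S I n d] is witnessed by a polynomial in
some number [m <= n] of indeterminates, and [m] varies.  But one may always take
[m = n].  A non-increasing sequence of length [n] in [I] restricts to one of
length [m], at which the smaller polynomial takes the same value
([admits_pattern_mpoly_incl]); and renaming indeterminates does not raise the
degree ([msize_mpoly_incl]).  Hence [patternsP]: a pattern is just a polynomial
in [n] indeterminates, admitted by [I] and of degree at most [d]. *)

Set Implicit Arguments.
Unset Strict Implicit.
Unset Printing Implicit Defensive.

Import GRing.Theory.

Local Open Scope ring_scope.

(** Widening along [leqnn n] does not change the value of an index, and an
indeterminate depends on its index only through that value; hence the
substituted tuple is convertible to the tuple of all indeterminates. *)
Lemma mpoly_incl_id (n : nat) (p : {mpoly int[n]}) :
  mpoly_incl (leqnn n) p = p.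
Proof. exact: comp_mpoly_id. Qed.

Lemma meval_mpoly_incl (m n : nat) (le_mn : (m <= n)%N) (p : {mpoly int[m]})
    (v : 'I_n -> int) :
  (mpoly_incl le_mn p).@[v] = p.@[fun i => v (widen_ord le_mn i)].
Proof.
rewrite comp_mpoly_meval; apply: meval_eq => i.
by rewrite tnth_mktuple mevalXU.
Qed.

(** Each monomial of [p] is sent to a monomial with the same total degree, so
no term of the image has a degree above that of [p]. *)
Lemma msize_mpoly_incl (m n : nat) (le_mn : (m <= n)%N) (p : {mpoly int[m]}) :
  (msize (mpoly_incl le_mn p) <= msize p)%N.
Proof.
rewrite /mpoly_incl comp_mpolyE.
apply: leq_trans (msize_sum _ _ _) _.
apply/bigmax_leqP_seq => k k_p _.
under eq_bigr do rewrite tnth_mktuple.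
rewrite mprodXnE (leq_trans (mmeasureZ_le _ _ _)) // msizeX.
rewrite mdeg_sum; under eq_bigr do rewrite mdegMn mdeg1 mul1n.
by rewrite -mdegE msize_mdeg_lt.
Qed.

Lemma admits_pattern_mpoly_incl (S I : set nat) (m n : nat)
    (le_mn : (m <= n)%N) (p : {mpoly int[m]}) :
  admits_pattern S I p -> admits_pattern S I (mpoly_incl le_mn p).
Proof.
move=> adm s Is s_noninc; rewrite meval_mpoly_incl.
by apply: adm => [i|i j le_ij]; [apply: Is | apply: s_noninc].
Qed.

(** The included polynomial can itself serve as the witness, in [n]
indeterminates, so that two patterns can be added within a single ring. *)
Lemma patternsP (S I : set nat) (n d : nat) (q : {mpoly int[n]}) :
  patterns S I n d q <-> admits_pattern S I q /\ (msize q <= d.+1)%N.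
Proof.
split=> [[m [le_mn [p [adm szp ->]]]]|[adm szq]].
  split; first exact: admits_pattern_mpoly_incl.
  exact: leq_trans (msize_mpoly_incl _ _) szp.
by exists n, (leqnn n), q; rewrite mpoly_incl_id.
Qed.

Lemma admits_pattern0 (S I : set nat) (n : nat) :
  S 0%N -> admits_pattern S I (0 : {mpoly int[n]}).
Proof. by move=> S0 s _ _; exists 0%N => //; rewrite meval0. Qed.

Lemma admits_patternD (S I : set nat) (n : nat) (p q : {mpoly int[n]}) :
  (forall a b, S a -> S b -> S (a + b)%N) ->
  admits_pattern S I p -> admits_pattern S I q -> admits_pattern S I (p + q).
Proof.
move=> SD admp admq s Is s_noninc.
have [a Sa pE] := admp s Is s_noninc; have [b Sb qE] := admq s Is s_noninc.
by exists (a + b)%N; [apply: SD | rewrite mevalD pE qE].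
Qed.

Theorem lemma28 (S I : set nat) (hS : numerical_semigroup S)
    (hI : semigroup_ideal S I) (n d : nat) :
  monoid_under (patterns S I n d) (@GRing.add {mpoly int[n]}) (0%R : {mpoly int[n]}).
Proof.
have [S0 SD _] := hS.
split; last by move=> x _; rewrite add0r addr0.
  split=> [x y|x y z _ _ _]; last exact: addrA.
  rewrite !patternsP => -[admx szx] [admy szy]; split.
    exact: admits_patternD.
  by apply: leq_trans (msizeD_le _ _) _; rewrite geq_max szx szy.
by apply/patternsP; split; [exact: admits_pattern0 | rewrite msize0].
Qed.
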